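(* Let $m$ and $n$ be integers with $2\le m\le n$. If $n\ge 2m-1$, then $L(m,n)\le \dfrac{mn-1}{m-1}$.
   Context: Let $m,n$ be integers with $2\le m\le n$. An $m$ by $n$ array consists of $mn$ cells arranged in $m$ rows and $n$ columns, each cell containing exactly one symbol (symbols are arbitrary and may repeat). A transversal of an array consists of $m$ cells, one from each row and no two from the same column. A latin transversal is a transversal in which no symbol appears more than once. $L(m,n)$ denotes the largest integer such that every $m$ by $n$ array in which each symbol appears at most $L(m,n)$ times has a latin transversal. *)

(* Defs.v *)
From mathcomp Require Import all_boot all_order all_algebra.
From mathcomp Require Import boolp classical_sets.

Set Implicit Arguments.
Unset Strict Implicit.
Unset Printing Implicit Defensive.

Local Open Scope nat_scope.

Definition cells (m n : nat) : finType := ('I_m * 'I_n)%type.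

(* As a set of cells; that it has exactly [m] of them follows from the first
   clause. *)
Definition transversal (m n : nat) (X : {set cells m n}) : Prop :=
  (forall i : 'I_m, #|[set c in X | c.1 == i]| = 1) /\ {in X &, injective snd}.

Definition latin_transversal (m n : nat) (T : eqType) (A : 'M[T]_(m, n))
    (X : {set cells m n}) : Prop :=
  transversal X /\ {in X &, injective (fun c : cells m n => A c.1 c.2)}.

Definition each_symbol_at_most (m n : nat) (T : eqType) (A : 'M[T]_(m, n))
    (k : nat) : Prop :=
  forall s : T, #|[set c : cells m n | A c.1 c.2 == s]| <= k.

(* The symbols are arbitrary, so the symbol type is quantified here. *)
Definition forces_latin (m n k : nat) : Prop :=
  forall (T : eqType) (A : 'M[T]_(m, n)),
    each_symbol_at_most A k -> exists X, latin_transversal A X.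

Definition largest (P : nat -> Prop) (l : nat) : Prop :=
  P l /\ forall k, P k -> k <= l.

(* The default value 0 is used only when there is no largest [k]; [L_largest]
   shows that this does not happen for [2 <= m <= n]. *)
Definition L (m n : nat) : nat :=
  xget 0 [set l | largest (forces_latin m n) l]%classic.

Lemma forces_latin0 (m n : nat) : 0 < m -> 0 < n -> forces_latin m n 0.
Proof.
move=> m0 n0 T A /(_ (A (Ordinal m0) (Ordinal n0))).
rewrite leqn0 cards_eq0 => /eqP/setP/(_ (Ordinal m0, Ordinal n0)).
by rewrite !inE /= eqxx.
Qed.

Lemma forces_latin_bound (m n k : nat) :
  1 < m -> forces_latin m n k -> k <= m * n.
Proof.
move=> m1 Pk; rewrite leqNgt; apply/negP => lt_k.
have m0 : 0 < m by apply: ltnW.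
have [|X [[row1 _] injA]] := Pk unit (const_mx tt).
  move=> s; apply: leq_trans (ltnW lt_k).
  by rewrite (leq_trans (max_card _)) // card_prod !card_ord.
have get (i : 'I_m) : exists2 c, c \in X & c.1 = i.
  have /card_gt0P[c] : 0 < #|[set c in X | c.1 == i]| by rewrite row1.
  by rewrite inE => /andP[cX /eqP]; exists c.
have [c cX c0] := get (Ordinal m0); have [d dX d1] := get (Ordinal m1).
have cd : c = d by apply: injA => //; rewrite !mxE.
by move: d1; rewrite -cd c0 => /(congr1 val).
Qed.

Lemma L_largest (m n : nat) :
  2 <= m -> m <= n -> largest (forces_latin m n) (L m n).
Proof.
move=> m2 mn; have m0 : 0 < m by apply: ltnW.
pose P k := `[< forces_latin m n k >].
have P0 : exists k, P k.
  by exists 0; apply/asboolP/forces_latin0 => //; apply: leq_trans mn.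
have Pub k : P k -> k <= m * n by move=> /asboolP; apply: forces_latin_bound.
case: (ex_maxnP P0 Pub) => l /asboolP Pl lmax.
have : largest (forces_latin m n) l by split=> // k Pk; apply/lmax/asboolP.
by move=> Ll; exact: (@xgetI _ 0 [set l | largest (forces_latin m n) l]%classic l Ll).
Qed.

(* Main.v *)
Require Import Defs.
From mathcomp Require Import all_boot all_order all_algebra.

Import Order.TTheory GRing.Theory Num.Theory.

(** A latin transversal of an array with [m] rows uses [m] distinct symbols, so
    an array filled with only [m - 1] symbols has none
    ([latin_transversal_symbols]).  When [m * n <= (m - 1) * k], such an array
    can be filled with each symbol used at most [k] times: cut the list of all
    cells into blocks of length [k] and give each block its own symbol
    ([block_array]).  Hence [k] forces a latin transversal only if
    [(m - 1) * k < m * n], and the value [L m n] is such a [k]. *)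

Lemma card_transversal (m n : nat) (X : {set cells m n}) :
  Defs.transversal X -> #|X| = m.
Proof.
case=> row1 _; rewrite -sum1_card (partition_big fst predT) //=.
under eq_bigr => i _ do rewrite sum1dep_card row1.
by rewrite sum1_card card_ord.
Qed.

Lemma latin_transversal_symbols (m n : nat) (T : finType) (A : 'M[T]_(m, n))
    (X : {set cells m n}) :
  latin_transversal A X -> m <= #|T|.
Proof.
by case=> /card_transversal cardX injA; rewrite -[leqLHS]cardX -(card_in_imset injA) max_card.
Qed.

Lemma block_array (m n p k : nat) :
  m * n <= p * k -> exists A : 'M['I_p]_(m, n), each_symbol_at_most A k.
Proof.
move=> le_pk; have card_cells : #|{: cells m n}| = m * n.
  by rewrite card_prod !card_ord.
have lt_pk (c : cells m n) : enum_rank c < p * k.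
  by apply: leq_trans (ltn_ord _) _; rewrite card_cells.
have k_gt0 (c : cells m n) : 0 < k.
  by have := lt_pk c; case: k {le_pk lt_pk}; rewrite ?muln0.
have blockP (c : cells m n) : enum_rank c %/ k < p.
  by rewrite ltn_divLR ?lt_pk // k_gt0.
exists (\matrix_(i, j) Ordinal (blockP (i, j)))%R => s.
set S := [set c | _]; have [->|[c0 _]] := set_0Vmem S; first by rewrite cards0.
(* Within a block, a cell is determined by its offset modulo [k]. *)
pose offset (c : cells m n) : 'I_k := Ordinal (ltn_pmod (enum_rank c) (k_gt0 c0)).
have inj_offset : {in S &, injective offset}.
  case=> i j [i' j']; rewrite !inE !mxE /= => /eqP eq_s /eqP eq_s' [eq_mod].
  apply/enum_rank_inj/val_inj => /=.
  rewrite (divn_eq (enum_rank (i, j)) k) (divn_eq (enum_rank (i', j')) k) eq_mod.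
  by have /(congr1 val)/= -> := etrans eq_s (esym eq_s').
by rewrite -(card_in_imset inj_offset) (leq_trans (max_card _)) ?card_ord.
Qed.

Lemma forces_latin_lt (m n k : nat) :
  0 < m -> forces_latin m n k -> k * m.-1 < m * n.
Proof.
move=> m_gt0 forces; rewrite ltnNge (mulnC k); apply/negP => /block_array[A Ak].
have [X /latin_transversal_symbols] := forces _ A Ak.
by rewrite card_ord leqNgt prednK ?leqnn.
Qed.

Theorem theorem2 (m n : nat) (hm : (2 <= m)%N) (hmn : (m <= n)%N)
    (hn : (2 * m - 1 <= n)%N) :
  (((L m n)%:R : rat) <= ((m * n)%:R - 1) / (m%:R - 1))%R.
Proof.
have [forces _] := L_largest hm hmn.
have lt_L := forces_latin_lt _ _ _ (ltnW hm) forces.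
have pred_gt0 : (0 < m%:R - 1 :> rat)%R by rewrite subr_gt0 ltr1n.
rewrite ler_pdivlMr // lerBrDr -(natrB _ (ltnW hm)) -natrM natr1 ler_nat.
by rewrite subn1.
Qed.
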